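(* Let $D$ be the formal derivative with respect to the context-free grammar $G\colon x\to xy,\ y\to xz,\ z\to zw,\ w\to xz$. For $n\ge 0$ let $$P_n(x,y,z,w)=\sum_{i,j}P_n(i,j)\,x^i y^j z^{i+1} w^{n-2i-j},$$ where $P_n(i,j)$ is the number of permutations of $[n]=\{1,\dots,n\}$ with $i$ exterior peaks and $j$ proper double descents. Then for all $n\ge 0$, $$D^n(z)=P_n(x,y,z,w).$$
   Context: Let $x,y,z,w$ be commuting variables. The formal derivative $D$ with respect to the grammar $G$ is the linear operator on Laurent polynomials in $x,y,z,w$ satisfying $D(uv)=uD(v)+vD(u)$, $D(c)=0$ for constants $c$, and $D(x)=xy$, $D(y)=xz$, $D(z)=zw$, $D(w)=xz$; $D^0$ is the identity. For a permutation $\pi=\pi_1\pi_2\cdots\pi_n$ of $[n]$, an index $i$ is an exterior peak if either $i=1$ and $\pi_1>\pi_2$ (requiring $n\ge 2$), or $1<i<n$ and $\pi_{i-1}<\pi_i>\pi_{i+1}$. An index $i$ is a proper double descent if $3\le i\le n$ and $\pi_{i-2}>\pi_{i-1}>\pi_i$. For $n=0$ the empty permutation is counted once with $0$ exterior peaks and $0$ proper double descents, so $P_0=z$. *)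

(* Defs.v *)
From HB Require Import structures.
From mathcomp Require Import all_boot all_order all_fingroup all_algebra.
From mathcomp Require Import finmap.
From mathcomp.multinomials Require Import monalg.

Set Implicit Arguments.
Unset Strict Implicit.
Unset Printing Implicit Defensive.

Import GRing.Theory.

Local Open Scope fset_scope.
Local Open Scope ring_scope.

(* The {malg R[K]} of monalg is only a ring when K is a monoid without         *)
(* nontrivial units, which excludes negative exponents.  We therefore put the  *)
(* convolution product of the group algebra R[Z^4] on an alias of the free     *)
(* module {malg R[Z^4]} of finitely supported families of coefficients.        *)
Definition expo : Type := (int * int * int * int)%type.
HB.instance Definition _ := GRing.Zmodule.copy expo (int * int * int * int)%type.

Definition laurent (R : comNzRingType) : Type := {malg R[expo]}.

HB.instance Definition _ (R : comNzRingType) :=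
  GRing.Lmodule.copy (laurent R) {malg R[expo]}.

(* lterm c (a, b, d, e) is c x^a y^b z^d w^e. *)
HB.lock Definition lterm (R : comNzRingType) (c : R) (k : expo) : laurent R :=
  << c *g k >>.

HB.lock Definition lmul (R : comNzRingType) (g1 g2 : laurent R) : laurent R :=
  \sum_(k1 <- msupp g1) \sum_(k2 <- msupp g2)
    lterm (g1@_k1 * g2@_k2) (k1 + k2).

Section LaurentRing.
Variable R : comNzRingType.
Local Notation L := (laurent R).
Local Notation lmul := (@lmul R).
Implicit Types (c : R) (g : L) (k : expo).

Definition lone : L := lterm 1 0.

Lemma lterm0 k : lterm (0 : R) k = 0.
Proof. by rewrite lterm.unlock monalgU0. Qed.

Lemma ltermD c1 c2 k : lterm (c1 + c2) k = lterm c1 k + lterm c2 k.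
Proof. by rewrite lterm.unlock monalgUD. Qed.

Lemma msupp_lterm c k : msupp (lterm c k) `<=` [fset k].
Proof. by rewrite lterm.unlock msuppU_le. Qed.

Lemma mcoeff_lterm c k : (lterm c k)@_k = c.
Proof. by rewrite lterm.unlock mcoeffUU. Qed.

Lemma laurentE g : g = \sum_(k <- msupp g) lterm g@_k k.
Proof. by rewrite lterm.unlock -monalgE. Qed.

Lemma lscale_term c1 c2 k : c1 *: lterm c2 k = lterm (c1 * c2) k.
Proof.
by rewrite lterm.unlock; apply/malgP => k'; rewrite mcoeffZ !mcoeffU mulrnAr.
Qed.

Lemma lmulw (d1 d2 : {fset expo}) g1 g2 : msupp g1 `<=` d1 -> msupp g2 `<=` d2 ->
  lmul g1 g2 =
    \sum_(k1 <- d1) \sum_(k2 <- d2) lterm (g1@_k1 * g2@_k2) (k1 + k2).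
Proof.
move=> le_d1 le_d2; rewrite lmul.unlock (big_fset_incl _ le_d1) /=.
  apply/eq_bigr=> k1 _; apply/big_fset_incl => // k _ /mcoeff_outdom ->.
  by rewrite mulr0 lterm0.
move=> k _ /mcoeff_outdom g1k.
by rewrite big1 => // k' _; rewrite g1k mul0r lterm0.
Qed.

Lemma lmulC : commutative lmul.
Proof.
move=> g1 g2; rewrite lmul.unlock exchange_big.
by apply/eq_bigr=> k2 _; apply/eq_bigr=> k1 _; rewrite mulrC addrC.
Qed.

Lemma lmul_term c1 c2 k1 k2 :
  lmul (lterm c1 k1) (lterm c2 k2) = lterm (c1 * c2) (k1 + k2).
Proof.
rewrite (lmulw (msupp_lterm _ _) (msupp_lterm _ _)) !big_seq_fset1.
by rewrite !mcoeff_lterm.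
Qed.

Lemma lmulDl : left_distributive lmul +%R.
Proof.
move=> g1 g2 g.
rewrite [in RHS](lmulw (fsubsetUl _ (msupp g2)) (fsubset_refl (msupp g))).
rewrite [in RHS](lmulw (fsubsetUr (msupp g1) _) (fsubset_refl (msupp g))).
rewrite (lmulw (msuppD_le _ _) (fsubset_refl (msupp g))).
rewrite -big_split /=; apply/eq_bigr=> k1 _.
rewrite -big_split /=; apply/eq_bigr=> k2 _.
by rewrite mcoeffD mulrDl ltermD.
Qed.

Lemma lmul0l : left_zero 0 lmul.
Proof. by move=> g; rewrite lmul.unlock msupp0 big_seq_fset0. Qed.

Lemma lmul_suml (I : Type) (r : seq I) (F : I -> L) g :
  lmul (\sum_(i <- r) F i) g = \sum_(i <- r) lmul (F i) g.
Proof. exact: (big_morph (lmul^~ g) (fun _ _ => lmulDl _ _ _) (lmul0l g)). Qed.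

Lemma lmul_sumr (I : Type) (r : seq I) (F : I -> L) g :
  lmul g (\sum_(i <- r) F i) = \sum_(i <- r) lmul g (F i).
Proof. by rewrite lmulC lmul_suml; apply: eq_bigr => i _; rewrite lmulC. Qed.

Lemma lmulA : associative lmul.
Proof.
move=> g1 g2 g3; rewrite [g1]laurentE !lmul_suml; apply: eq_bigr => k1 _.
rewrite [g2]laurentE lmul_suml !lmul_sumr lmul_suml; apply: eq_bigr => k2 _.
rewrite [g3]laurentE !lmul_sumr; apply: eq_bigr => k3 _.
by rewrite !lmul_term mulrA (addrA k1).
Qed.

Lemma lmul1l : left_id lone lmul.
Proof.
move=> g; rewrite [g]laurentE lmul_sumr; apply: eq_bigr => k _.
by rewrite lmul_term mul1r add0r.
Qed.

Lemma lone_neq0 : lone != 0.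
Proof. by rewrite /lone lterm.unlock monalgU_eq0 oner_eq0. Qed.

HB.instance Definition _ := GRing.Zmodule_isComNzRing.Build L
  lmulA lmulC lmul1l lmulDl lone_neq0.

Lemma lmulE c1 c2 k1 k2 :
  lterm c1 k1 * lterm c2 k2 = lterm (c1 * c2) (k1 + k2).
Proof. exact: lmul_term. Qed.

Lemma lscaleAl c g1 g2 : c *: (g1 * g2) = (c *: g1) * g2.
Proof.
rewrite [g1]laurentE [g2]laurentE mulr_suml !scaler_sumr mulr_suml.
apply: eq_bigr => k1 _; rewrite !mulr_sumr scaler_sumr.
by apply: eq_bigr => k2 _; rewrite lscale_term !lmulE lscale_term mulrA.
Qed.

HB.instance Definition _ := GRing.Lmodule_isLalgebra.Build R L lscaleAl.
HB.instance Definition _ := GRing.Lalgebra_isComAlgebra.Build R L.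

Definition lmon (a b d e : int) : L := lterm 1 (a, b, d, e).

Lemma lmonM a b d e a' b' d' e' :
  lmon a b d e * lmon a' b' d' e' = lmon (a + a') (b + b') (d + d') (e + e').
Proof. by rewrite /lmon lmulE mulr1. Qed.

Definition lx : L := lmon 1 0 0 0.
Definition ly : L := lmon 0 1 0 0.
Definition lz : L := lmon 0 0 1 0.
Definition lw : L := lmon 0 0 0 1.

Definition formal_derivative (D : L -> L) : Prop :=
  [/\ linear D,
      forall u v : L, D (u * v) = u * D v + v * D u,
      forall c : R, D c%:A = 0 &
      [/\ D lx = lx * ly, D ly = lx * lz, D lz = lz * lw & D lw = lx * lz]].

(* formal_derivative is inhabited: on a monomial, D acts as multiplication by  *)
(* a D(x)/x + b D(y)/y + d D(z)/z + e D(w)/w.                                  *)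
Definition dlog (k : expo) : L :=
  lmon 0 1 0 0 *~ k.1.1.1 + lmon 1 (-1) 1 0 *~ k.1.1.2 +
  lmon 0 0 0 1 *~ k.1.2 + lmon 1 0 1 (-1) *~ k.2.

Definition grammar_derivative (g : L) : L :=
  \sum_(k <- msupp g) lterm g@_k k * dlog k.

Lemma grammar_derivativew (d : {fset expo}) g : msupp g `<=` d ->
  grammar_derivative g = \sum_(k <- d) lterm g@_k k * dlog k.
Proof.
move=> le; rewrite /grammar_derivative (big_fset_incl _ le) //= => k _.
by move=> /mcoeff_outdom ->; rewrite lterm0 mul0r.
Qed.

Lemma grammar_derivative_term c k :
  grammar_derivative (lterm c k) = lterm c k * dlog k.
Proof.
by rewrite (grammar_derivativew (msupp_lterm _ _)) big_seq_fset1 mcoeff_lterm.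
Qed.

Lemma grammar_derivative_linear : linear grammar_derivative.
Proof.
move=> c g1 g2; set d := msupp (c *: g1 + g2) `|` (msupp g1 `|` msupp g2).
have s1 : msupp g1 `<=` d by rewrite /d fsubsetU // fsubsetUl orbT.
have s2 : msupp g2 `<=` d by rewrite /d fsubsetU // fsubsetUr orbT.
rewrite (grammar_derivativew s1) (grammar_derivativew s2).
rewrite (@grammar_derivativew d) ?fsubsetUl //.
rewrite scaler_sumr -big_split /=; apply: eq_bigr => k _.
by rewrite mcoeffD mcoeffZ ltermD mulrDl -lscale_term -scalerAl.
Qed.

Lemma dlogD k1 k2 : dlog (k1 + k2) = dlog k1 + dlog k2.
Proof.
have addr4ACA (V : zmodType) (a a' b b' c c' d d' : V) :
    a + a' + (b + b') + (c + c') + (d + d') =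
    (a + b + c + d) + (a' + b' + c' + d').
  by rewrite (addrACA a) (addrACA (a + b)) (addrACA (a + b + c)).
have e1 : (k1 + k2).1.1.1 = k1.1.1.1 + k2.1.1.1 by [].
have e2 : (k1 + k2).1.1.2 = k1.1.1.2 + k2.1.1.2 by [].
have e3 : (k1 + k2).1.2 = k1.1.2 + k2.1.2 by [].
have e4 : (k1 + k2).2 = k1.2 + k2.2 by [].
by rewrite /dlog e1 e2 e3 e4 !mulrzDr addr4ACA.
Qed.

Lemma grammar_derivativeM g1 g2 :
  grammar_derivative (g1 * g2) =
  g1 * grammar_derivative g2 + g2 * grammar_derivative g1.
Proof.
pose lin := GRing.isLinear.Build R L L *:%R _ grammar_derivative_linear.
pose D : {linear L -> L} := HB.pack grammar_derivative lin.
have Dsum (r : seq expo) (F : expo -> L) :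
    grammar_derivative (\sum_(k <- r) F k) =
    \sum_(k <- r) grammar_derivative (F k) by exact: (raddf_sum D).
pose B u v := grammar_derivative (u * v) =
  u * grammar_derivative v + v * grammar_derivative u.
have Bsum u (r : seq expo) (F : expo -> L) :
    (forall k, B u (F k)) -> B u (\sum_(k <- r) F k).
  move=> BF; rewrite /B mulr_sumr !Dsum mulr_sumr mulr_suml -big_split /=.
  by apply: eq_bigr => k _; apply: BF.
have BC u v : B u v -> B v u by rewrite /B mulrC addrC.
rewrite -/(B g1 g2) [g1]laurentE; apply/BC/Bsum => k2; apply/BC.
rewrite [g2]laurentE; apply: Bsum => k1; rewrite /B.
rewrite lmulE !grammar_derivative_term -lmulE dlogD mulrDr addrC.
by rewrite -mulrA [_ * lterm _ k1]mulrC -mulrA.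
Qed.

Lemma grammar_derivativeP : formal_derivative grammar_derivative.
Proof.
split; [exact: grammar_derivative_linear | exact: grammar_derivativeM | |].
  move=> c; rewrite lscale_term grammar_derivative_term /dlog !mulr0z.
  by rewrite !addr0 mulr0.
by split; rewrite grammar_derivative_term /dlog /= ?mulr1z ?mulr0z ?addr0
  ?add0r !lmonM.
Qed.

End LaurentRing.

(* The one-line notation of s : 'S_n has letters 1..n, while 'I_n is 0..n-1;   *)
(* letter s k is the k-th letter for 1 <= k <= n (and is not used otherwise).  *)
Definition letter n (s : 'S_n) (k : nat) : nat :=
  nth 0%N [seq (s i : nat).+1 | i <- enum 'I_n] k.-1.

Definition exterior_peak n (s : 'S_n) (i : nat) : bool :=
  [&& i == 1, 1 < n & letter s 1 > letter s 2]%N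
  || [&& 1 < i, i < n, letter s i.-1 < letter s i
      & letter s i > letter s i.+1]%N.

Definition proper_double_descent n (s : 'S_n) (i : nat) : bool :=
  [&& 3 <= i, i <= n, letter s (i - 2) > letter s (i - 1)
    & letter s (i - 1) > letter s i]%N.

Definition nb_exterior_peaks n (s : 'S_n) : nat :=
  count (exterior_peak s) (iota 1 n).

Definition nb_proper_double_descents n (s : 'S_n) : nat :=
  count (proper_double_descent s) (iota 1 n).

Definition Pcoef (n i j : nat) : nat :=
  #|[set s : 'S_n | (nb_exterior_peaks s == i)
                 && (nb_proper_double_descents s == j)]|.

Fact Pcoef_eq0 n i j : ~~ ((i <= n) && (j <= n))%N -> Pcoef n i j = 0%N.
Proof.
move=> out; apply/eqP; rewrite cards_eq0; apply/eqP/setP => s; rewrite !inE.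
apply: contraNF out => /andP[/eqP<- /eqP<-].
have le p : (count p (iota 1 n) <= n)%N by rewrite -{2}(size_iota 1 n) count_size.
by rewrite !le.
Qed.

(* By Pcoef_eq0 the index bounds lose no term.  The exponent of w is the       *)
(* integer n - 2i - j, not a truncated subtraction.                            *)
Definition Ppoly (R : comNzRingType) (n : nat) : laurent R :=
  \sum_(i < n.+1) \sum_(j < n.+1)
    lmon R i%:Z j%:Z (i%:Z + 1) (n%:Z - 2 * i%:Z - j%:Z) *+ Pcoef n i j.

(* Main.v *)
(** The derivative acts on the descent word d_0 ... d_(n-1) of a permutation,
    d_k being the truth value of pi_k > pi_(k+1) with pi_0 = 0.  An exterior
    peak is a factor FT of this word and a proper double descent is a factor
    TT, so the monomial of a permutation is z times the product obtained by
    reading each factor FT as xz, each other F as w and each other T as y.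
    Inserting the letter n+1 either replaces one letter of the word by FT or
    appends F, which is what the substitution rules of the grammar do to the
    monomial. *)
Require Import Defs.
From mathcomp Require Import all_boot all_algebra.
From HB Require Import structures.
From mathcomp Require Import all_fingroup zify ring.

Set Implicit Arguments.
Unset Strict Implicit.
Unset Printing Implicit Defensive.

Import GRing.Theory.
Local Open Scope ring_scope.

Definition descent_word (a : nat) (u : seq nat) : seq bool :=
  pairmap (fun b c => c < b)%N a u.

Fixpoint expansions (d : seq bool) : seq (seq bool) :=
  if d is b :: r then (false :: true :: r) :: map (cons b) (expansions r)
  else [:: [:: false]].

(** [N] exceeds both neighbours, so the step into it is F and the step out of it, if any, is T; all
    comparisons away from [N] are kept. *)
Lemma descent_word_insert (N a : nat) (u : seq nat) :
    (a < N)%N -> all (gtn N) u ->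
  [seq descent_word a (take i u ++ N :: drop i u) | i <- iota 0 (size u).+1]
    = expansions (descent_word a u).
Proof.
elim: u a => [|b u IH] a aN; first by rewrite /= ltnNge ltnW.
case/andP=> bN uN; rewrite -[iota _ _]/(0%N :: iota (1 + 0) (size u).+1) iotaDl.
rewrite map_cons -map_comp /= -IH // -[in RHS]map_comp.
by rewrite /= (bN : b < N)%N [(N < a)%N]ltnNge (ltnW aN).
Qed.

Section Weight.
Variable R : comNzRingType.
Local Notation L := (laurent R).

(* [p] records that the letter before the word is an F whose factor is still
   undetermined: xz if T comes next, w otherwise. *)
Fixpoint weight (p : bool) (d : seq bool) : L :=
  match d with
  | [::] => (if p then lw R else 1) * lz R
  | true :: r => (if p then lx R * lz R else ly R) * weight false r
  | false :: r => (if p then lw R else 1) * weight true r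
  end.

(** Induction on [d] with the product rule. A pending F can itself become FT although it is not a
    letter of [d]; the last summand accounts for this. *)
Lemma derivative_weight (D : L -> L) (hD : formal_derivative D) p d :
  D (weight p d) = \sum_(e <- expansions d) weight p e
                   + (if p then weight false (false :: true :: d) else 0).
Proof.
case: hD => _ DM Dc [Dx Dy Dz Dw].
have D1 : D 1 = 0 by rewrite -(Dc 1) scale1r.
elim: d p => [|b d IH] p; first by
  rewrite /= big_seq1 /=; case: p; rewrite DM ?Dw ?Dz ?D1; ring.
rewrite /= big_cons big_map; case: b => /=.
  rewrite DM (IH false) addr0 -mulr_sumr.
  by case: p; rewrite ?DM ?Dx ?Dy ?Dz; ring.
rewrite DM (IH true) -mulr_sumr /=.
by case: p; rewrite ?Dw ?D1; ring.
Qed.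

(** A pending F acts as the preceding letter [~~ p] and adds [p] to the length. With none pending,
    that letter is a virtual T, so that a leading T counts in [j], matching its factor y. *)
Lemma weight_lmon p d :
  let i := count id (pairmap (fun b c => ~~ b && c) (~~ p) d) in
  let j := count id (pairmap andb (~~ p) d) in
  weight p d =
    lmon R i%:Z j%:Z (i%:Z + 1) ((size d + p)%:Z - 2 * i%:Z - j%:Z).
Proof.
have lmon1 : 1 = lmon R 0 0 0 0 by [].
elim: d p => [|b d IH] p /=.
  by case: p; rewrite ?lmon1 lmonM.
by case: b; case: p; rewrite /= IH ?lmon1 !lmonM /=; congr lmon; lia.
Qed.

End Weight.

(** This is the list inside [letter]: [letter s k] unfolds to its entry of index [k.-1]. *)
Definition one_line n (s : 'S_n) : seq nat := [seq (s i : nat).+1 | i <- enum 'I_n].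

Lemma size_one_line n (s : 'S_n) : size (one_line s) = n.
Proof. by rewrite size_map size_enum_ord. Qed.

Lemma one_line_bound n (s : 'S_n) : all (gtn n.+1) (one_line s).
Proof. by apply/allP => _ /mapP[i _ ->] /=; rewrite ltnS. Qed.

Lemma one_line_uniq n (s : 'S_n) : uniq (one_line s).
Proof.
by rewrite map_inj_uniq ?enum_uniq // => i j [] /val_inj /perm_inj.
Qed.

Lemma nth_one_line n (s : 'S_n) (i : 'I_n) : nth 0%N (one_line s) i = (s i).+1.
Proof. by rewrite (nth_map i) ?size_enum_ord // nth_ord_enum. Qed.

Lemma one_line_lift_perm n (s : 'S_n) (i : 'I_n.+1) :
  one_line (lift_perm i ord_max s) =
    take i (one_line s) ++ n.+1 :: drop i (one_line s).
Proof.
have size_take_i : size (take i (one_line s)) = i.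
  by rewrite size_takel // size_one_line -ltnS.
apply: (@eq_from_nth _ 0%N) => [|k].
  rewrite size_cat /= size_take_i size_drop !size_one_line.
  by have := ltn_ord i; lia.
rewrite size_one_line => lt_k; rewrite -[k]/(val (Ordinal lt_k)) nth_one_line.
case: (unliftP i (Ordinal lt_k)) => [j|] ->.
  rewrite lift_perm_lift !lift_max -nth_one_line nth_cat size_take_i /= /bump.
  case: (leqP i j) => [le_ij | lt_ji].
    by rewrite ltnNge leqW // subSn //= nth_drop subnKC.
  by rewrite add0n lt_ji nth_take.
by rewrite lift_perm_id nth_cat size_take_i ltnn subnn.
Qed.

(** Injectivity suffices, since n! (n+1) = (n+1)!; the position [i] is recovered as the place of the
    maximum. *)
Lemma lift_perm_max_bij n :
  bijective (fun c : 'S_n * 'I_n.+1 => lift_perm c.2 ord_max c.1).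
Proof.
apply: inj_card_bij => [[s i] [t j] /= eq_st|]; last first.
  by rewrite card_prod card_ord !card_Sn factS mulnC.
have eq_ij : i = j.
  by apply: (@perm_inj _ (lift_perm i ord_max s)); rewrite {2}eq_st !lift_perm_id.
rewrite -{}eq_ij in eq_st *; congr pair; apply/permP => k.
by apply: (@lift_inj _ ord_max); rewrite -!(lift_perm_lift i) eq_st.
Qed.

Lemma big_perm_insert (V : nmodType) n (F : seq nat -> V) :
  \sum_(s : 'S_n.+1) F (one_line s) =
  \sum_(s : 'S_n) \sum_(i <- iota 0 n.+1)
    F (take i (one_line s) ++ n.+1 :: drop i (one_line s)).
Proof.
rewrite (reindex _ (onW_bij _ (@lift_perm_max_bij n))).
rewrite -(pair_bigA _ (fun s i => F (one_line (lift_perm i ord_max s)))).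
apply: eq_bigr => s _; rewrite -[iota 0 _]/(index_iota 0 n.+1) big_mkord.
by apply: eq_bigr => i _; rewrite one_line_lift_perm.
Qed.

Lemma iter_derivative (R : comNzRingType) (D : laurent R -> laurent R)
    (hD : formal_derivative D) n :
  iter n D (lz R) =
    \sum_(s : 'S_n) weight R false (descent_word 0 (one_line s)).
Proof.
elim: n => [|n IH].
  rewrite (eq_bigr (fun=> lz R)) => [|s _].
    by rewrite sumr_const card_Sn.
  by rewrite (size0nil (size_one_line s)) /= mul1r.
have [linD _ _ _] := hD.
pose lin := GRing.isLinear.Build R (laurent R) (laurent R) *:%R _ linD.
pose Dl : {linear laurent R -> laurent R} := HB.pack D lin.
rewrite iterS IH -[D]/(Dl : _ -> _) (raddf_sum Dl) /=.
rewrite (big_perm_insert n (fun u => weight R false (descent_word 0 u))).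
(* No F is pending before the whole word, so the extra term is 0. *)
apply: eq_bigr => s _; rewrite (derivative_weight hD) addr0.
by rewrite -(@descent_word_insert n.+1) ?one_line_bound // big_map size_one_line.
Qed.

(** Words are indexed from 0 and letters from 1; index 0 compares with pi_0 = 0, hence is never a
    descent. *)
Lemma nth_descent_word n (s : 'S_n) k : (k < n)%N ->
  nth false (descent_word 0 (one_line s)) k =
    if k is k'.+1 then (letter s k'.+2 < letter s k'.+1)%N else false.
Proof.
move=> lt_k; rewrite (nth_pairmap 0%N) ?size_one_line //.
by case: k lt_k.
Qed.

Lemma count_pairmap (f : rel bool) b d :
  count id (pairmap f b d) =
  count (fun k => f (nth false (b :: d) k) (nth false d k)) (iota 0 (size d)).
Proof.
rewrite -[pairmap f b d](mkseq_nth false) count_map size_pairmap.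
by apply: eq_in_count => k; rewrite mem_iota => /= lt_k; rewrite (nth_pairmap false).
Qed.

(** A peak at [i] is a factor FT whose T has index [i]. The initial [true] cannot start such a
    factor. *)
Lemma nb_exterior_peaksE n (s : 'S_n) :
  nb_exterior_peaks s =
    count id (pairmap (fun b c => ~~ b && c) true (descent_word 0 (one_line s))).
Proof.
rewrite count_pairmap size_pairmap size_one_line.
(* Neither 0 nor [n] is a peak, so the range can be shifted to the indices of the word. *)
have -> : nb_exterior_peaks s = count (exterior_peak s) (iota 0 n).
  have peak_n : exterior_peak s n = false.
    by rewrite /exterior_peak ltnn andbF orbF; case: (ltngtP n 1).
  have := congr1 (count (exterior_peak s)) (iotaD 0 n 1).
  by rewrite addn1 count_cat /= peak_n !addn0.
apply: eq_in_count => k; rewrite mem_iota add0n => /= lt_k.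
rewrite nth_descent_word //; case: k lt_k => [|k] lt_k //=.
rewrite nth_descent_word ?(ltnW lt_k) // /exterior_peak.
case: k lt_k => [|k] lt_k /=; first by rewrite lt_k orbF.
rewrite lt_k /= -leqNgt ltn_neqAle; congr (_ && _).
(* Letters are distinct, so a non-descent is a strict ascent. *)
suff -> : letter s k.+1 != letter s k.+2 by [].
by rewrite nth_uniq ?one_line_uniq ?size_one_line ?ltn_eqF // ltnW // ltnW.
Qed.

Lemma nb_proper_double_descentsE n (s : 'S_n) :
  nb_proper_double_descents s =
    count id (pairmap andb true (descent_word 0 (one_line s))).
Proof.
rewrite count_pairmap size_pairmap size_one_line.
(* A double descent at [i] is a factor TT ending at index [i - 1], hence this shift. The initial
   [true] adds none, as the word cannot start with T. *)
rewrite /nb_proper_double_descents -[1%N]/(1 + 0)%N iotaDl count_map.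
apply: eq_in_count => k; rewrite mem_iota add0n => /= lt_k.
rewrite nth_descent_word // /proper_double_descent /= add1n lt_k.
case: k lt_k => [|k] lt_k //=; rewrite nth_descent_word ?(ltnW lt_k) //.
by case: k lt_k => [|k] lt_k //=; rewrite !subSS !subn0.
Qed.

(** The weight depends only on the two statistics, so the permutations are grouped by their
    values. *)
Lemma PpolyE (R : comNzRingType) n :
  Ppoly R n = \sum_(s : 'S_n) weight R false (descent_word 0 (one_line s)).
Proof.
have le_n (p : pred nat) : (count p (iota 1 n) < n.+1)%N.
  by rewrite ltnS -{2}(size_iota 1 n) count_size.
rewrite [RHS](partition_big
  (fun s => (Ordinal (le_n (exterior_peak s)),
             Ordinal (le_n (proper_double_descent s)))) xpredT) //=.
rewrite /Ppoly pair_bigA; apply: eq_bigr => -[i j] _ /=.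
rewrite /Pcoef -sumr_const; apply: eq_big => [s|s]; first by rewrite inE.
rewrite inE => /andP[/eqP <- /eqP <-].
rewrite weight_lmon /= -nb_exterior_peaksE -nb_proper_double_descentsE.
by rewrite size_pairmap size_one_line addn0.
Qed.

Theorem theorem2p1 (R : comNzRingType) (D : laurent R -> laurent R)
  (hD : formal_derivative D) (n : nat) :
  iter n D (lz R) = Ppoly R n.
Proof. by rewrite (iter_derivative hD) PpolyE. Qed.
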